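(* Let $d\ge 2$ be a natural number. For $1\le i\le d$, let $X_{(i)}$ be the $i$-th order statistic of a statistical sample of size $d$ (that is, of independent and identically distributed random variables $X_1,\ldots,X_d$ with distribution function $F$ and density function $f$) from a decreasing failure rate (DFR) distribution $F$. Let $D_1=X_{(1)}$ and $D_i=X_{(i)}-X_{(i-1)}$ for $i=2,\ldots,d$. Then the random variables $D_1,D_2,\ldots,D_d$ are conditionally increasing in sequence (CIS).
   Context: The $i$-th order statistic $X_{(i)}$ is the $i$-th smallest value among $X_1,\ldots,X_d$ (so $X_{(1)}=\min\{X_1,\ldots,X_d\}$ and $X_{(d)}=\max\{X_1,\ldots,X_d\}$). DFR: let $X$ be a random variable with distribution function $F$. Then $F$ is said to be decreasing failure rate (DFR) if $\mathbb{P}[X>x+y\mid X>x]$ is a nondecreasing function of $x$ for all $y\ge 0$; equivalently, writing $\overline{F}(x)=1-F(x)$, if $\overline{F}(x+y)/\overline{F}(x)$ is nondecreasing in $x$ for all $y\ge 0$. CIS: random variables $Y_1,\ldots,Y_d$ are conditionally increasing in sequence (CIS) if $\mathbb{P}[Y_i>y_i\mid Y_1=y_1,\ldots,Y_{i-1}=y_{i-1}]$ is nondecreasing in $y_1,\ldots,y_{i-1}$, for every $2\le i\le d$ and for all $y_i\in\overline{\mathbb{R}}=[-\infty,\infty]$. *)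

(* Defs.v *)
From HB Require Import structures.
From mathcomp Require Import all_boot all_order all_algebra.
From mathcomp Require Import all_classical all_reals all_analysis.
From mathcomp Require Import measurable_realfun.

Set Implicit Arguments.
Unset Strict Implicit.
Unset Printing Implicit Defensive.

Import Order.TTheory GRing.Theory Num.Theory.
Import numFieldNormedType.Exports.

Local Open Scope classical_set_scope.
Local Open Scope ring_scope.

(* Indices are 0-based throughout: [order_stat X k] is the (k+1)-th smallest
   value, so k = 0 is the minimum; the value for k >= n is irrelevant. *)
Section order_statistics.
Context (d : measure_display) (T : measurableType d) (R : realType)
  (P : probability T R) (n : nat).
Variable X : 'I_n -> {RV P >-> R}.

Definition order_stat (k : nat) (w : T) : R :=
  nth 0 (sort <=%R [seq X j w | j <- enum 'I_n]) k.

Let size_sample w : size (sort <=%R [seq X j w | j <- enum 'I_n]) = n.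
Proof. by rewrite size_sort size_map size_enum_ord. Qed.

Let order_stat_lt k w r : (k < n)%N ->
  (order_stat k w < r) = (k < count (< r) [seq X j w | j <- enum 'I_n])%N.
Proof.
move=> kn; have ss := sort_le_sorted [seq X j w | j <- enum 'I_n].
rewrite -(count_sort <=%R); apply/idP/idP => [|kc]; last exact: nth_count_lt.
apply: contraTT; rewrite -leqNgt -leNgt => ck.
by apply: nth_count_ge => //; rewrite ck size_sample.
Qed.

Lemma measurable_order_stat k : measurable_fun setT (order_stat k).
Proof.
have [nk|kn] := leqP n k.
  rewrite (_ : order_stat k = cst 0); first exact: measurable_cst.
  by apply/funext => w; rewrite /order_stat nth_default// size_sample.
apply: (measurability _ (RGenInftyO.measurableE R)) => // _ [_ [r ->] <-].
pose c (w : T) : R := \sum_(j <- enum 'I_n) \1_(X j @^-1` `]-oo, r[) w.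
have mc : measurable_fun setT c.
  apply: measurable_sum => j; apply: measurable_indic.
  by rewrite -[_ @^-1` _]setTI; apply: measurable_funPT.
rewrite (_ : _ `&` _ = setT `&` c @^-1` `]k%:R, +oo[); first exact: mc.
congr (_ `&` _); apply/seteqP; have E w : c w =
    (count (< r) [seq X j w | j <- enum 'I_n])%:R.
  rewrite /c; elim: (enum _) => [|j s ih]; rewrite ?big_nil// big_cons/= ih natrD.
  congr (_ + _); rewrite indicE; congr (nat_of_bool _)%:R.
  by apply/idP/idP; rewrite inE/= in_itv.
by split=> w /=; rewrite !in_itv/= andbT E ltr_nat order_stat_lt.
Qed.

HB.instance Definition _ k :=
  isMeasurableFun.Build _ _ _ _ (order_stat k) (measurable_order_stat k).

Definition spacing (k : nat) : {RV P >-> R} :=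
  if k is k'.+1 then order_stat k'.+1 \- order_stat k' else order_stat 0.

End order_statistics.

(* Given [Y_0, ..., Y_(n-1)], the random vector [(Y_0, ..., Y_(i-1))]. *)
Section prefix.
Context (d : measure_display) (T : measurableType d) (R : realType)
  (P : probability T R) (n : nat).
Variables (Y : 'I_n -> {RV P >-> R}) (i : 'I_n).

Definition prefix_vector (w : T) : i.-tuple R :=
  [tuple Y (widen_ord (ltnW (ltn_ord i)) j) w | j < i].

Lemma measurable_prefix_vector : measurable_fun setT prefix_vector.
Proof.
apply/measurable_fun_tnthP => j.
rewrite (_ : _ \o _ = Y (widen_ord (ltnW (ltn_ord i)) j) :> (T -> R)).
  exact: measurable_funPT.
by apply/funext => w /=; rewrite tnth_mktuple.
Qed.

HB.instance Definition _ :=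
  isMeasurableFun.Build _ _ _ _ prefix_vector measurable_prefix_vector.

End prefix.

Section definitions.
Context (d : measure_display) (T : measurableType d) (R : realType)
  (P : probability T R).

Definition mutually_independent n (X : 'I_n -> {RV P >-> R}) : Prop :=
  forall (J : {set 'I_n}) (B : 'I_n -> set R), (forall j, measurable (B j)) ->
    (P (\bigcap_(j in [set` J]) (X j @^-1` B j)) =
     \prod_(j in J) P (X j @^-1` B j))%E.

Definition has_distribution_function (X : {RV P >-> R}) (F : R -> R) : Prop :=
  forall x, cdf X x = (F x)%:E.

Definition has_density (X : {RV P >-> R}) (f : R -> R) : Prop :=
  [/\ measurable_fun setT f, (forall x, 0 <= f x) &
      forall B : set R, measurable B ->
        distribution P X B = (\int[lebesgue_measure]_(x in B) (f x)%:E)%E].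

(* [g] is a version of [u |-> P[E | V = u]]. *)
Definition is_cond_prob (E : set T) d' (U : measurableType d')
    (V : {RV P >-> U}) (g : U -> R) : Prop :=
  [/\ measurable_fun setT g, (forall u, 0 <= g u <= 1) &
      forall B : set U, measurable B ->
        P (E `&` V @^-1` B) = (\int[distribution P V]_(u in B) (g u)%:E)%E].

(* Conditional probabilities given [Y_0, ..., Y_(i-1)] being defined only up to
   null sets, monotonicity is required of some version, on the whole of R^i. *)
Definition CIS n (Y : 'I_n -> {RV P >-> R}) : Prop :=
  forall i : 'I_n, (0 < i)%N -> forall y : \bar R,
    exists2 g : i.-tuple R -> R,
      is_cond_prob [set w | (y < (Y i w)%:E)%E] (prefix_vector Y i) g &
      forall u v, (forall j, tnth u j <= tnth v j) -> g u <= g v.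

End definitions.

(* The ratio is P[X > x + y | X > x], which is meaningful when F x < 1. The
   monotonicity is over the x with 0 < F x: to the left of the support the ratio
   is 1 for small y, and requiring it to be nondecreasing over the whole real
   line would be satisfied by no distribution function. For a nonnegative
   random variable, monotonicity over x >= 0 implies the condition below. *)
Definition DFR (R : realType) (F : R -> R) : Prop :=
  forall y x1 x2, 0 <= y -> x1 <= x2 -> 0 < F x1 -> F x2 < 1 ->
    (1 - F (x1 + y)) / (1 - F x1) <= (1 - F (x2 + y)) / (1 - F x2).

(* Main.v *)
(* Write r for the number of spacings conditioned upon. Almost surely there are
   no ties, so exactly one injection t : 'I_r -> 'I_d lists the indices of the r
   smallest values in increasing order. On the event that t does so, the first r
   spacings are a function of X o t, the r-th order statistic is the last entry
   M of X o t, and the next spacing exceeds y >= 0 iff every remaining X_j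
   exceeds M + y. The remaining X_j being independent of X o t, Fubini gives
   these events the conditional weights (1 - F(M + y))^(d-r) and, for y = 0,
   (1 - F(M))^(d-r). Summing over t, the conditional survival probability of the
   next spacing is ((1 - F(s + y)) / (1 - F(s)))^(d-r), where s = M is the sum of
   the first r spacings; it is nondecreasing in s because F is DFR. *)

From HB Require Import structures.
Require Import Defs.
From mathcomp Require Import all_boot all_order all_algebra.
From mathcomp Require Import all_classical all_reals all_analysis.
From mathcomp Require Import measurable_realfun.

Set Implicit Arguments.
Unset Strict Implicit.
Unset Printing Implicit Defensive.

Import Order.TTheory GRing.Theory Num.Theory.
Import numFieldNormedType.Exports.

Local Open Scope classical_set_scope.
Local Open Scope ring_scope.

(** * Boxes and the product sigma-algebra on pairs of tuples *)

Definition box (R : realType) n (A : 'I_n -> set R) : set (n.-tuple R) :=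
  [set u | forall l, A l (tnth u l)].

Lemma measurable_fin_forall d (T : measurableType d) (I : finType)
    (A : I -> set T) :
  (forall i, measurable (A i)) -> measurable [set x | forall i, A i x].
Proof.
move=> mA; rewrite (_ : [set x | _] = \bigcap_i A i).
  by apply: fin_bigcap_measurable => //; exact: finite_finset.
by apply/seteqP; split=> x h i; [move=> _; exact: h|exact: h].
Qed.

Lemma measurable_box (R : realType) n (A : 'I_n -> set R) :
  (forall l, measurable (A l)) -> measurable (box A).
Proof.
move=> mA; apply: measurable_fin_forall => l.
by rewrite -[X in measurable X]setTI; exact: measurable_tnth.
Qed.

(** Products of boxes are stable under intersection, and independence evaluates their probability
    directly. As a generating family they let uniqueness of measures be applied in
    [independent_subvectors]. *)
Lemma measurable_prod_boxE (R : realType) p q :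
  @measurable _ (p.-tuple R * q.-tuple R)%type =
  <<s [set box AB.1 `*` box AB.2 | AB in
     [set AB : ('I_p -> set R) * ('I_q -> set R) |
       (forall l, measurable (AB.1 l)) /\ forall l, measurable (AB.2 l)]] >>.
Proof.
set G := [set _ | _ in _]; apply/seteqP; split; last first.
  apply: smallest_sub; first exact: sigma_algebra_measurable.
  by move=> _ [[A B] [/= mA mB] <-]; apply: measurableX; exact: measurable_box.
(* Inclusion of the product sigma-algebra in the generated one amounts to measurability of the
   identity map [idG]. This is tested coordinate by coordinate, and each coordinate preimage is a
   product of boxes with one constrained side. *)
pose idG (z : g_sigma_algebraType G) : (p.-tuple R * q.-tuple R)%type := z.
suff mG : measurable_fun setT idG.
  by move=> S mS; have := mG measurableT S mS; rewrite setTI.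
apply/measurable_fun_pairP; split; apply/measurable_fun_tnthP => l _ B mB;
    rewrite setTI; apply: sub_sigma_algebra.
- exists ((fun k => if k == l then B else setT), (fun=> setT)) => /=.
    by split=> // k; case: ifP.
  apply/seteqP; split=> [[u v] [/= + _] /=|[u v] /= Bu].
    by move/(_ l); rewrite eqxx.
  by split=> //= k; case: eqP => // ->.
- exists ((fun=> setT), (fun k => if k == l then B else setT)) => /=.
    by split=> // k; case: ifP.
  apply/seteqP; split=> [[u v] [/= _ +] /=|[u v] /= Bu].
    by move/(_ l); rewrite eqxx.
  by split=> //= k; case: eqP => // ->.
Qed.

(** * Independence of disjoint subvectors *)

Section subvectors.
Context (d : measure_display) (T : measurableType d) (R : realType)
  (P : probability T R) (n : nat).
Variable X : 'I_n -> {RV P >-> R}.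

Definition subvector p (t : 'I_p -> 'I_n) (w : T) : p.-tuple R :=
  [tuple X (t l) w | l < p].

Lemma measurable_subvector p (t : 'I_p -> 'I_n) :
  measurable_fun setT (subvector t).
Proof.
apply/measurable_fun_tnthP => l.
rewrite (_ : _ \o _ = X (t l) :> (T -> R)); first exact: measurable_funPT.
by apply/funext => w /=; rewrite tnth_mktuple.
Qed.

HB.instance Definition _ p (t : 'I_p -> 'I_n) :=
  isMeasurableFun.Build _ _ _ _ (subvector t) (measurable_subvector t).

Hypothesis indX : mutually_independent X.

(** Since [t] may repeat an index, several sides of a box can constrain the same [X j]; they are
    intersected over the fibre of [t] above [j]. *)
Let pull p (t : 'I_p -> 'I_n) (A : 'I_p -> set R) (j : 'I_n) : set R :=
  [set x | forall l, t l = j -> A l x].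

Let measurable_pull p (t : 'I_p -> 'I_n) A j :
  (forall l, measurable (A l)) -> measurable (pull t A j).
Proof.
move=> mA; apply: measurable_fin_forall => l.
have [->|tlj] := eqVneq (t l) j.
  by rewrite [X in measurable X](_ : _ = A l)//; apply/seteqP; split=> x //; apply.
rewrite [X in measurable X](_ : _ = setT)//; apply/seteqP; split=> x // _ /eqP.
by rewrite (negbTE tlj).
Qed.

Let im p (t : 'I_p -> 'I_n) : {set 'I_n} := (t @: 'I_p)%SET.

Let preimage_box p (t : 'I_p -> 'I_n) A : subvector t @^-1` box A =
  \bigcap_(j in [set` im t]) (X j @^-1` pull t A j).
Proof.
apply/seteqP; split=> w.
  by move=> h j _ l <-; have := h l; rewrite tnth_mktuple.
by move=> h l; rewrite tnth_mktuple; apply: (h (t l)) => //=; exact: imset_f.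
Qed.

(** By independence the joint law and the product law agree on products of boxes, hence everywhere
    by uniqueness of measures. *)
Lemma independent_subvectors p q (t : 'I_p -> 'I_n) (s : 'I_q -> 'I_n)
    (S : set (p.-tuple R * q.-tuple R)) :
  (forall k l, t k != s l) -> measurable S ->
  P ((fun w => (subvector t w, subvector s w)) @^-1` S) =
  (distribution P (subvector t) \x distribution P (subvector s))%E S.
Proof.
move=> ts mS.
pose U w := (subvector t w, subvector s w).
have mU : measurable_fun setT U.
  by apply: measurable_fun_pair; exact: measurable_subvector.
pose mfU := isMeasurableFun.Build _ _ _ _ U mU.
pose V : {mfun T >-> (p.-tuple R * q.-tuple R)%type} := HB.pack U mfU.
have -> : P (U @^-1` S) = distribution P V S by [].
move: mS; apply: (measure_unique _ (fun=> setT)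
    (measurable_prod_boxE R p q)) => //.
- move=> _ _ [[A B] [/= mA mB] <-] [[A' B'] [/= mA' mB'] <-].
  exists ((fun l => A l `&` A' l), (fun l => B l `&` B' l)).
    by split=> l; exact: measurableI.
  rewrite -setXI; congr (_ `*` _); apply/seteqP; split=> u.
  + by move=> h; split=> l; have [] := h l.
  + by move=> [h h'] l; split.
  + by move=> h; split=> l; have [] := h l.
  + by move=> [h h'] l; split.
- move=> _; exists ((fun=> setT), (fun=> setT)) => //=.
  by apply/seteqP; split.
- by apply/seteqP; split=> // x _; exists 0%N.
- move=> _ [[A B] [/= mA mB] <-].
  rewrite product_measure1E; [|exact: measurable_box..].
  transitivity
    (P (subvector t @^-1` box A) * P (subvector s @^-1` box B))%E; last by [].
  rewrite !preimage_box.
  rewrite !indX; [|by move=> j; exact: measurable_pull..].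
  have disj : fintype.disjoint (mem (im t)) (mem (im s)).
    rewrite disjoint_subset; apply/fintype.subsetP => j /imsetP[k _ ->].
    by rewrite inE/=; apply/negP => /imsetP[l _ /eqP]; apply/negP.
  (* The images of [t] and [s] being disjoint, the single family [C] encodes both boxes, and
     independence over the union of the images splits into two products. *)
  pose C j := if j \in im t then pull t A j else pull s B j.
  have mC j : measurable (C j) by rewrite /C; case: ifP => _; exact: measurable_pull.
  have := indX (im t :|: im s)%SET mC.
  rewrite (eq_bigl [predU im t & im s]);
    last by move=> j; rewrite !inE.
  rewrite bigU//= => e.
  transitivity (P (\bigcap_(j in [set` (im t
      :|: im s)%SET]) X j @^-1` C j)).
    congr (P _); apply/seteqP; split=> w.
    + move=> [hA hB] j /= _; rewrite /C; case: ifPn => _ l <-.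
        by have := hA l; rewrite tnth_mktuple.
      by have := hB l; rewrite tnth_mktuple.
    + move=> h; split=> l; rewrite tnth_mktuple.
        have := h (t l); rewrite /= inE /C imset_f//=; exact.
      have := h (s l); rewrite /= inE /C [X in _ || X]imset_f ?orbT//=.
      case: ifP => [/imsetP[k _ /esym/eqP]|_]; first by rewrite (negbTE (ts _ _)).
      exact.
  rewrite e; congr (_ * _)%E; apply: eq_bigr => j jt; rewrite /C ?jt//.
  by rewrite (disjointFl disj).
- by move=> k; rewrite -ge0_fin_numE// fin_num_measure.
Qed.

Lemma independent_tails (F : R -> R) (K : {set 'I_n}) c :
  (forall j, has_distribution_function (X j) F) ->
  P (\bigcap_(j in [set` K]) (X j @^-1` `]c, +oo[)) = ((1 - F c) ^+ #|K|)%:E.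
Proof.
move=> hF; rewrite (indX K (B := fun=> `]c, +oo[%classic)) => [|j]; last by [].
have e j : P (X j @^-1` `]c, +oo[) = (1 - F c)%:E.
  have := cdf_ccdf_1 (X j) c; rewrite hF EFinB => <-.
  by rewrite [X in _ = (X - _)%E]addeC addeK.
rewrite (eq_bigr (fun=> (1 - F c)%:E)) => [|j _]; last exact: e.
by rewrite prodEFin prodr_const.
Qed.

End subvectors.

Lemma distribution_function_bounds (d : measure_display) (T : measurableType d)
    (R : realType) (P : probability T R) (X : {RV P >-> R}) (F : R -> R) :
  has_distribution_function X F ->
  [/\ forall x, 0 <= F x, forall x, F x <= 1 & nondecreasing_fun F].
Proof.
move=> hF; split=> [x|x|a b ab]; rewrite -lee_fin -!hF.
- exact: cdf_ge0.
- exact: cdf_le1.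
- exact: cdf_nondecreasing.
Qed.

(** * Null events: zeros of the distribution function, and ties *)

Section null_events.
Context (d : measure_display) (T : measurableType d) (R : realType)
  (P : probability T R).
Local Open Scope ereal_scope.

(** If the zeros of the cdf have a largest element [x], the event lies in the null event [X <= x].
    Otherwise each value taken on the event lies below a rational zero, and countably many null rays
    cover the event. *)
Lemma cdf_eq0_negligible (X : {RV P >-> R}) :
  P.-negligible [set w | cdf X (X w) = 0].
Proof.
have null_ray x : cdf X x = 0 -> P.-negligible (X @^-1` `]-oo, x]).
  by move=> Fx; apply/negligibleP => //; exact: measurable_funPTI.
have [[x [Fx0 xmax]]|nomax] :=
    pselect (exists x, cdf X x = 0 /\ forall z, cdf X z = 0 -> (z <= x)%R).
  apply: negligibleS (null_ray _ Fx0) => w /= Fw.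
  by rewrite in_itv/=; exact: xmax.
pose ray (q : rat) := [set w | (X w <= ratr q)%R /\ cdf X (ratr q) = 0].
have null_ray_rat q : P.-negligible (ray q).
  have [/null_ray|Fq] := pselect (cdf X (ratr q) = 0).
    by apply: negligibleS => w [wq _]; rewrite /= in_itv.
  by apply: negligibleS (negligible_set0 _) => w [].
apply: (@negligibleS _ _ _ _ (\bigcup_n oapp ray set0 (unpickle n))); last first.
  apply: negligible_bigcup => n; case: (unpickle n) => [q|]; first exact: null_ray_rat.
  exact: negligible_set0.
move=> w /= Fw.
have [z [Fz wz]] : exists z, cdf X z = 0 /\ (X w < z)%R.
  apply: contrapT => h; apply: nomax; exists (X w); split=> // z Fz.
  by rewrite leNgt; apply/negP => wz; apply: h; exists z.
have [q] := rat_in_itvoo wz; rewrite in_itv/= => /andP[wq qz].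
have [n nq] : exists n, unpickle n = Some q by exists (pickle q); exact: pickleK.
exists n; first by [].
rewrite nq; split; first exact: ltW.
apply/le_anti/andP; split; last exact: cdf_ge0.
by apply: le_trans (cdf_nondecreasing X (ltW qz)) _; rewrite Fz.
Qed.

Lemma atomless_has_density (X : {RV P >-> R}) (f : R -> R) x :
  has_density X f -> distribution P X [set x] = 0.
Proof.
move=> [mf f0 ->//]; apply: null_set_integral => //.
  by apply: measurable_funTS; exact/measurable_EFinP.
exact: lebesgue_measure_set1.
Qed.

(** For [j != k] the joint law of [X j] and [X k] is a product measure, and each section of the
    diagonal is a singleton, of mass 0. *)
Lemma ties_negligible n (X : 'I_n -> {RV P >-> R}) :
  mutually_independent X -> (forall j x, distribution P (X j) [set x] = 0) ->
  P.-negligible [set w | ~ injective (X ^~ w)].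
Proof.
move=> indX atomless.
pose tie jk := [set w | jk.1 != jk.2 /\ X jk.1 w = X jk.2 w].
apply: (@negligibleS _ _ _ _ (\big[setU/set0]_(jk : 'I_n * 'I_n) tie jk)).
  move=> w /= ninj; rewrite -bigcup_seq; apply: contrapT => h; apply: ninj.
  move=> j k e; apply/eqP/negPn/negP => jk; apply: h.
  by exists (j, k) => //=; rewrite mem_index_enum.
apply: (big_ind (fun A => P.-negligible A)); first exact: negligible_set0.
  exact: negligibleU.
move=> [j k] _; rewrite /tie/=.
have [->|jk] := eqVneq j k.
  by apply: negligibleS (negligible_set0 _) => w [].
(* The diagonal, written on one-entry tuples so that [independent_subvectors] applies. *)
pose S := [set z : 1.-tuple R * 1.-tuple R | tnth z.1 ord0 == tnth z.2 ord0].
have mS : measurable S.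
  rewrite -[S]setTI; apply: (measurable_fun_eqr _ _ measurableT
      (Y := [set true])) => //.
  - exact: (measurableT_comp (measurable_tnth ord0) measurable_fst).
  - exact: (measurableT_comp (measurable_tnth ord0) measurable_snd).
have := independent_subvectors (t := fun=> j) (s := fun=> k) indX (fun _ _ => jk) mS.
rewrite [RHS]integral0_eq => [P0|u _]; last first.
  rewrite /= /distribution /pushforward -(atomless k (tnth u ord0)).
  congr (P _); apply/seteqP; split=> w; rewrite /S /= /xsection/= inE/=.
    by rewrite tnth_mktuple => /eqP <-.
  by rewrite tnth_mktuple => ->.
exists ((fun w => (subvector X (fun=> j) w, subvector X (fun=> k) w)) @^-1` S).
split=> //.
  rewrite -[X in measurable X]setTI.
  by apply: (measurable_fun_pair (measurable_subvector X _)
    (measurable_subvector X _)).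
by move=> w [_ e]; rewrite /S /= !tnth_mktuple e.
Qed.
End null_events.

(** * Integrating out the remaining variables *)

Section conditioning_on_a_subvector.
Context (d : measure_display) (T : measurableType d) (R : realType)
  (P : probability T R) (n : nat).
Variables (X : 'I_n -> {RV P >-> R}) (F : R -> R).
Hypotheses (indX : mutually_independent X)
  (hF : forall j, has_distribution_function (X j) F).
Variables (p : nat) (t : 'I_p -> 'I_n) (l : 'I_p) (K : {set 'I_n}).
Hypothesis tK : forall k, t k \notin K.

Lemma measurable_above_subvector y (C : set (p.-tuple R)) : measurable C ->
  measurable [set z : p.-tuple R * #|K|.-tuple R |
    C z.1 /\ forall k, tnth z.1 l + y < tnth z.2 k].
Proof.
move=> mC; apply: measurableI.
  by rewrite -[X in measurable X]setTI; exact: measurable_fst.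
apply: measurable_fin_forall => k; rewrite -[X in measurable X]setTI.
apply: (measurable_fun_ltr _ _ measurableT (Y := [set true])) => //.
- apply: measurable_funD => //.
  exact: (measurableT_comp (measurable_tnth l) measurable_fst).
- exact: (measurableT_comp (measurable_tnth k) measurable_snd).
Qed.

Let above_preimage y (C : set (p.-tuple R)) :
  [set w | C (subvector X t w) /\
     forall j, j \in K -> X (t l) w + y < X j w] =
  (fun w => (subvector X t w, subvector X (@enum_val _ (mem K)) w)) @^-1`
  [set z | C z.1 /\ forall k, tnth z.1 l + y < tnth z.2 k].
Proof.
apply/seteqP; split=> w /= [Cw h]; split=> //.
  by move=> k; rewrite !tnth_mktuple; apply: h; exact: enum_valP.
move=> j jK; have := h (enum_rank_in jK j).
by rewrite !tnth_mktuple enum_rankK_in.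
Qed.

Lemma measurable_above y (C : set (p.-tuple R)) : measurable C ->
  measurable [set w | C (subvector X t w) /\
    forall j, j \in K -> X (t l) w + y < X j w].
Proof.
move=> mC; rewrite above_preimage -[X in measurable X]setTI.
apply: (measurable_fun_pair (measurable_subvector X _)
  (measurable_subvector X _)) => //.
exact: measurable_above_subvector.
Qed.

(** The [X j] with [j] in [K] are independent of the subvector, so Fubini integrates them out: for
    fixed [u], they all exceed [tnth u l + y] with probability [(1 - F (tnth u l + y)) ^+ #|K|]. The
    weight [h] will be 1 in one use and the tail ratio in another. *)
Lemma integral_above y (C : set (p.-tuple R)) (h : R -> R) :
  measurable C -> measurable_fun setT h -> (forall x, 0 <= h x) ->
  (\int[P]_(w in [set w | C (subvector X t w) /\
      forall j, j \in K -> (X (t l) w + y < X j w)%R]) (h (X (t l) w))%:E =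
   \int[distribution P (subvector X t)]_(u in C)
     (h (tnth u l) * (1 - F (tnth u l + y)) ^+ #|K|)%:E)%E.
Proof.
move=> mC mh h0; rewrite above_preimage.
set S := (X in _ @^-1` X); set s := @enum_val _ _.
pose V w := (subvector X t w, subvector X s w).
have mV : measurable_fun setT V.
  by apply: measurable_fun_pair; exact: measurable_subvector.
have mS : measurable S by exact: measurable_above_subvector.
pose H (z : p.-tuple R * #|K|.-tuple R) := (h (tnth z.1 l))%:E.
have mH : measurable_fun setT H.
  apply/measurable_EFinP; apply: (measurableT_comp mh).
  exact: (measurableT_comp (measurable_tnth l) measurable_fst).
have H0 z : (0 <= H z)%E by rewrite lee_fin.
transitivity (\int[P]_(w in V @^-1` S) (H \o V) w)%E.
  by apply: eq_integral => w _; rewrite /= /H tnth_mktuple.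
rewrite -(ge0_integral_pushforward mV)//; last exact: measurable_funTS.
rewrite (eq_measure_integral
  (distribution P (subvector X t) \x distribution P (subvector X s))%E); last first.
  move=> A mA _; apply: independent_subvectors => // k k'.
  by apply: contra (tK k) => /eqP ->; exact: enum_valP.
rewrite integral_mkcond fubini_tonelli1; last 2 first.
- by apply/(measurable_restrictT _ _).1 => //; exact: measurable_funTS.
- by move=> z; rewrite patchE; case: ifP.
rewrite [RHS]integral_mkcond; apply: eq_integral => u _.
rewrite /fubini_F patchE; case: ifPn => [|uC]; last first.
  apply: integral0_eq => v _; rewrite patchE ifF//; apply/negP.
  by rewrite inE => -[/= Cu _]; move: uC; rewrite notin_setE.
rewrite inE => Cu.
(* For [u] in [C], the section of [S] at [u] is [D]. *)
pose D := [set v : #|K|.-tuple R | forall k, tnth u l + y < tnth v k].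
have mD : measurable D.
  apply: measurable_fin_forall => k; rewrite -[X in measurable X]setTI.
  apply: (measurable_fun_ltr _ _ measurableT (Y := [set true])) => //.
  exact: measurable_tnth.
transitivity (\int[distribution P (subvector X s)]_(v in D) (h (tnth u l))%:E)%E.
  rewrite [RHS]integral_mkcond; apply: eq_integral => v _.
  rewrite !patchE; have [vD|vD] := boolP (v \in D).
    by rewrite ifT//; move: vD; rewrite !inE.
  rewrite ifF//; apply/negP; rewrite inE => -[_ /= uv].
  by move: vD; rewrite notin_setE.
rewrite integral_cst// EFinM -(independent_tails indX K _ hF); congr (_ * _)%E.
congr (P _); apply/seteqP; split=> w /=.
  move=> h' j /= jK; have := h' (enum_rank_in jK j).
  by rewrite tnth_mktuple /s enum_rankK_in// in_itv/= andbT.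
move=> h' k; have := h' (s k) (enum_valP k).
by rewrite tnth_mktuple /= in_itv/= andbT.
Qed.

End conditioning_on_a_subvector.

(** * Order statistics of distinct values *)

Section order_statistics_of_distinct_values.
Context (R : realType) (n r' : nat).
Local Notation r := r'.+1.
Variables (x : 'I_n -> R) (t : {ffun 'I_r -> 'I_n}) (y : R).
Hypotheses (injx : injective x) (rn : (r < n)%N) (y0 : 0 <= y).

Local Notation s := (sort <=%R [seq x j | j <- enum 'I_n]).
Local Notation os k := (nth 0 s k).

Let size_s : size s = n.
Proof. by rewrite size_sort size_map size_enum_ord. Qed.

Lemma order_stat_attained k : (k < n)%N -> exists j, x j = os k.
Proof.
move=> kn; have : os k \in s by rewrite mem_nth// size_s.
by rewrite mem_sort => /mapP[j _ ->]; exists j.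
Qed.

Let val_os j : exists2 k, (k < n)%N & os k = x j.
Proof.
have xs : x j \in s by rewrite mem_sort map_f// mem_enum.
by exists (index (x j) s); [rewrite -[X in (_ < X)%N]size_s index_mem|exact: nth_index].
Qed.

Let sorted_s : sorted <%R s.
Proof.
rewrite sort_lt_sorted map_inj_uniq ?enum_uniq//.
Qed.

Lemma order_stat_lt k l : (l < n)%N -> (k < l)%N -> os k < os l.
Proof.
move=> ln kl; have := (sorted_ltn_nth lt_trans 0 sorted_s).
by apply => //; rewrite inE size_s// (ltn_trans kl).
Qed.

Lemma leading_order_statsP :
  ((forall k : 'I_r, x (t k) = os k) /\ y < os r - os r') <->
  ((forall k l : 'I_r, (k < l)%N -> x (t k) < x (t l)) /\
   forall j, j \notin codom t -> x (t ord_max) + y < x j).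
Proof.
split=> [[xt ys]|[incr tail]].
  split=> [k l kl|j jt].
    by rewrite !xt; apply: order_stat_lt => //; exact: ltn_trans rn.
  have [k kn kj] := val_os j; rewrite -kj xt addrC -ltrBrDr.
  apply: lt_le_trans ys _; rewrite lerD2r.
  (* Here [k] is the rank of [x j]. Were it below [r], injectivity of [x] would put [j] in the range
     of [t]; so [x j] is at least the order statistic of index [r]. *)
  have [kr|] := ltnP k r.
    by case/negP: jt; apply/codomP; exists (Ordinal kr); apply: injx; rewrite xt.
  by rewrite leq_eqVlt => /predU1P[->//|rk]; rewrite ltW// order_stat_lt.
have injt : injective t.
  move=> k l ekl; apply/val_inj; have [kl|lk|//] := ltngtP k l.
    by have := incr _ _ kl; rewrite ekl ltxx.
  by have := incr _ _ lk; rewrite ekl ltxx.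
pose a := [seq x j | j <- codom t].
pose b := sort <=%R [seq x j | j <- enum (~: [set j in codom t])].
have memb z : z \in b -> exists2 j, j \notin codom t & z = x j.
  by rewrite mem_sort => /mapP[j]; rewrite mem_enum !inE => jt ->; exists j.
have xa k : nth 0 a (k : 'I_r) = x (t k).
  rewrite (nth_map (t k)); last by rewrite size_codom card_ord.
  by congr (x _); rewrite codomE (nth_map k) ?size_enum_ord// nth_ord_enum.
have sa : size a = r by rewrite size_map size_codom card_ord.
(* A sorted permutation is unique. The list [a ++ b] is sorted because each entry of [a] is at most
   [x (t ord_max)], which lies below each entry of [b] as [0 <= y]. *)
have sE : s = a ++ b.
  apply: (@sorted_eq _ <=%R); [exact: le_trans|exact: le_anti| | |].
  - exact: (sort_sorted le_total).
  - have la : pairwise <=%R a.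
      apply/(pairwiseP 0) => k l; rewrite !inE sa => kr lr kl.
      by rewrite (xa (Ordinal kr)) (xa (Ordinal lr)) ltW// incr.
    rewrite sorted_pairwise; last exact: le_trans.
    rewrite pairwise_cat la -sorted_pairwise; last exact: le_trans.
    rewrite (sort_sorted le_total) !andbT; apply/allrelP => z1 z2.
    move=> /mapP[_ /codomP[k ->] ->] /memb[j jt ->]; rewrite ltW//.
    apply: le_lt_trans (tail _ jt); rewrite ler_wpDr//.
    have := leq_ord k; rewrite leq_eqVlt => /predU1P[kr|kr].
      by rewrite (_ : k = ord_max)//; exact: val_inj.
    by rewrite ltW// incr.
  - rewrite (permPl (permEl (perm_sort _ _))) perm_sym.
    rewrite (perm_trans (y := a ++ [seq x j | j <- enum (~: [set j in codom t])]))//.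
      by rewrite perm_cat2l (permPl (permEl (perm_sort _ _))).
    rewrite /a -map_cat perm_map// uniq_perm//.
    + rewrite cat_uniq enum_uniq andbT map_inj_uniq ?enum_uniq//=.
      by apply/hasPn => j; rewrite mem_enum !inE.
    + exact: enum_uniq.
    + by move=> j; rewrite mem_cat !mem_enum !inE; case: (j \in codom t).
have osa k : os (k : 'I_r) = x (t k) by rewrite sE nth_cat sa ltn_ord xa.
split=> [k|]; first by rewrite osa.
rewrite (osa ord_max) ltrBrDl.
(* Index [r] is the first position of [b] in [a ++ b], and [b] is nonempty because [r < n]. *)
have /memb[j jt] : os r \in b.
  rewrite sE nth_cat sa ltnn subnn mem_nth//.
  have := size_s; rewrite sE size_cat sa => e.
  by rewrite -(ltn_add2l r) addn0 e.
by move=> ->; exact: tail.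
Qed.

End order_statistics_of_distinct_values.

(** * The ratio of tails *)

Section tail_ratio.
Context (R : realType) (F : R -> R) (y : R) (m : nat).
Hypotheses (F0 : forall x, 0 <= F x) (F1 : forall x, F x <= 1)
  (ndF : nondecreasing_fun F) (y0 : 0 <= y).

(* Only the values at 0 < F s < 1 matter: F = 0 is a null event for the sample,
   and where F s = 1 both tails vanish. The values 0 and 1 keep the function
   nondecreasing on the whole line. *)
Definition tail_ratio (s : R) : R :=
  if F s == 0 then 0 else if F s == 1 then 1 else
  ((1 - F (s + y)) / (1 - F s)) ^+ m.

Let ratio_ge0 s : 0 <= (1 - F (s + y)) / (1 - F s).
Proof. by rewrite divr_ge0 ?subr_ge0. Qed.

Let ratio_le1 s : F s != 1 -> (1 - F (s + y)) / (1 - F s) <= 1.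
Proof.
move=> Fs; rewrite ler_pdivrMr ?subr_gt0 ?lt_neqAle ?Fs ?F1//.
by rewrite mul1r lerD2l lerN2 ndF// lerDl.
Qed.

Lemma tail_ratio_ge0 s : 0 <= tail_ratio s.
Proof. by rewrite /tail_ratio; do 2 case: ifP => // _; exact: exprn_ge0. Qed.

Lemma tail_ratio_le1 s : tail_ratio s <= 1.
Proof.
rewrite /tail_ratio; case: ifP => // _; case: ifPn => // Fs.
by rewrite exprn_ile1// ratio_le1.
Qed.

Lemma tail_ratio_nondecreasing : DFR F -> nondecreasing_fun tail_ratio.
Proof.
move=> dfr s1 s2 s12; rewrite {1}/tail_ratio; case: ifPn => [_|Fs1].
  exact: tail_ratio_ge0.
have Fs1_gt0 : 0 < F s1 by rewrite lt_neqAle eq_sym Fs1 F0.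
have Fs2_gt0 : 0 < F s2 by rewrite (lt_le_trans Fs1_gt0)// ndF.
case: ifPn => [/eqP Fs1_1|Fs1_lt1]; rewrite /tail_ratio gt_eqF//.
  by rewrite ifT// eq_le F1 -Fs1_1 ndF.
case: ifPn => Fs2_1; first by rewrite exprn_ile1// ratio_le1.
rewrite lerXn2r ?nnegrE// dfr//.
by rewrite lt_neqAle Fs2_1 F1.
Qed.

(** Converts the weight for threshold 0 into the weight for threshold [y]. Where [F s = 1],
    monotonicity forces [F (s + y) = 1] and both sides are the same power of 0; elsewhere the
    denominator cancels. *)
Lemma tail_ratioE s : (0 < m)%N -> F s != 0 ->
  tail_ratio s * (1 - F s) ^+ m = (1 - F (s + y)) ^+ m.
Proof.
move=> m0 Fs; rewrite /tail_ratio (negbTE Fs); case: ifPn => [/eqP Fs1|Fs1].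
  have -> : F (s + y) = 1 by apply/le_anti; rewrite F1 -Fs1 ndF// lerDl.
  by rewrite Fs1 mul1r.
by rewrite -exprMn divfK// subr_eq0 eq_sym.
Qed.

End tail_ratio.

(** * Conditional law of a spacing given the preceding ones *)

Section spacings.
Context (d : measure_display) (T : measurableType d) (R : realType)
  (P : probability T R) (n r' : nat).
Local Notation r := r'.+1.
Variables (X : 'I_n -> {RV P >-> R}) (F : R -> R).
Hypotheses (rn : (r < n)%N) (indX : mutually_independent X)
  (hF : forall j, has_distribution_function (X j) F)
  (atomless : forall j x, distribution P (X j) [set x] = 0%E).

Local Notation V := (prefix_vector (fun i : 'I_n => spacing X i) (Ordinal rn)).

(** By telescoping, the last order statistic conditioned upon is a function of the conditioning
    vector. *)
Lemma sum_spacing k w : \sum_(l < k.+1) spacing X l w = order_stat X k w.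
Proof.
elim: k => [|k ih]; first by rewrite big_ord_recl big_ord0 addr0.
by rewrite big_ord_recr/= ih addrC subrK.
Qed.

(* The spacings recovered from increasingly ordered values. *)
Definition increments (u : r.-tuple R) : r.-tuple R :=
  [tuple if l : nat is k.+1 then tnth u l - tnth u (inord k) else tnth u l
    | l < r].

Lemma measurable_increments : measurable_fun setT increments.
Proof.
apply/measurable_fun_tnthP => -[l lr].
rewrite (_ : _ \o _ = fun u : r.-tuple R =>
  if l is k.+1 then tnth u (Ordinal lr) - tnth u (inord k)
  else tnth u (Ordinal lr)); last first.
  by apply/funext => u /=; rewrite tnth_mktuple.
case: l lr => [|l] lr; first exact: measurable_tnth.
by apply: measurable_funB; exact: measurable_tnth.
Qed.

Definition increasing_part (B : set (r.-tuple R)) : set (r.-tuple R) :=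
  [set u | B (increments u) /\
    forall k l : 'I_r, (k < l)%N -> tnth u k < tnth u l].

Lemma measurable_increasing_part B :
  measurable B -> measurable (increasing_part B).
Proof.
move=> mB; apply: measurableI.
  by rewrite -[X in measurable X]setTI; exact: measurable_increments.
apply: measurable_fin_forall => k; apply: measurable_fin_forall => l.
have [kl|lk] := boolP (k < l)%N; last first.
  by rewrite [X in measurable X](_ : _ = setT)//; apply/seteqP; split.
rewrite [X in measurable X](_ : _ =
    [set u : r.-tuple R | tnth u k < tnth u l]).
  rewrite -[X in measurable X]setTI.
  apply: (measurable_fun_ltr _ _ measurableT (Y := [set true])) => //;
    exact: measurable_tnth.
by apply/seteqP; split=> u //; apply.
Qed.

Definition complement (t : {ffun 'I_r -> 'I_n}) : {set 'I_n} :=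
  [set j | j \notin codom t]%SET.

(** Stated without order statistics, in the form required by [integral_above]; its meaning in terms
    of spacings is [leadingP]. *)
Definition leading (B : set (r.-tuple R)) y (t : {ffun 'I_r -> 'I_n}) : set T :=
  [set w | increasing_part B (subvector X t w) /\
    forall j, j \in complement t -> X (t ord_max) w + y < X j w].

Lemma leadingP B y t w : 0 <= y -> injective (X ^~ w) ->
  leading B y t w <->
  [/\ B (V w), y < spacing X r w &
      forall k : 'I_r, X (t k) w = order_stat X k w].
Proof.
move=> y0 injX.
have VE : (forall k : 'I_r, X (t k) w = order_stat X k w) ->
    increments (subvector X t w) = V w.
  move=> tE; apply: eq_from_tnth => -[[|l] lr].
    by rewrite !tnth_mktuple/= tE.
  by rewrite !tnth_mktuple/= tE tnth_mktuple tE/= inordK// ltnW.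
have /= tP := leading_order_statsP t injX rn y0.
split=> [[[Bw incr] tail]|[Bw yD tE]].
- have [tE yD] : (forall k : 'I_r, X (t k) w = order_stat X k w) /\
      y < order_stat X r w - order_stat X r' w.
    apply/tP; split=> [k l kl|j jt]; last by apply: tail; rewrite inE.
    by have := incr _ _ kl; rewrite !tnth_mktuple.
  by split=> //; rewrite -VE.
- have [incr tail] := tP.1 (conj tE yD).
  split; last by move=> j; rewrite inE; exact: tail.
  split; first by rewrite VE.
  by move=> k l kl; rewrite !tnth_mktuple; exact: incr.
Qed.

(** Off the null set of ties, the events [leading B y t] partition the domain of integration. On
    each of them the order statistic of index [r'] is [X (t ord_max)], so [integral_above] evaluates
    its contribution. *)
Lemma integral_spacing_gt B y (h : R -> R) : 0 <= y ->
  measurable B -> measurable_fun setT h -> (forall x, 0 <= h x) ->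
  (\int[P]_(w in [set w | (y < spacing X r w)%R] `&` V @^-1` B)
     (h (order_stat X r' w))%:E =
   \sum_(t : {ffun 'I_r -> 'I_n})
     \int[distribution P (subvector X t)]_(u in increasing_part B)
       (h (tnth u ord_max) * (1 - F (tnth u ord_max + y)) ^+ #|complement t|)%:E)%E.
Proof.
move=> y0 mB mh h0.
have [N [mN N0 tiesN]] := ties_negligible indX atomless.
have injN w : ~ N w -> injective (X ^~ w).
  by move=> Nw; apply: contrapT => /tiesN.
have mlead t : measurable (leading B y t).
  by apply: measurable_above; exact: measurable_increasing_part.
have mhos : measurable_fun setT (fun w => (h (order_stat X r' w))%:E).
  by apply/measurable_EFinP; apply: measurableT_comp mh _; exact: measurable_order_stat.
rewrite (ge0_negligible_integral mN)//; last 3 first.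
- apply: measurableI; rewrite -[X in measurable X]setTI.
    by apply: (measurable_fun_ltr _ _ measurableT (Y := [set true])).
  exact: measurable_prefix_vector.
- exact: measurable_funTS.
- by move=> w _; rewrite lee_fin.
rewrite (_ : _ `\` N = \big[setU/set0]_(t : {ffun 'I_r -> 'I_n})
    (leading B y t `\` N)); last first.
  rewrite -bigcup_seq; apply/seteqP; split=> w /=.
    move=> [[yD Bw] Nw].
    (* Each of the [r] smallest values is attained at some index; choosing these indices gives the
       [t] of the partition. *)
    have /choice[t tE] (k : 'I_r) : exists j, X j w = order_stat X k w.
      by apply: (order_stat_attained (X ^~ w)); exact: ltn_trans rn.
    exists [ffun k => t k]; first by rewrite /= mem_index_enum.
    split=> //; apply/leadingP => //; first exact: injN.
    by split=> // k; rewrite ffunE.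
  by move=> [t _ [/leadingP l1 Nw]]; have [] := l1 y0 (injN _ Nw).
rewrite ge0_integral_bigsetU//=; last 5 first.
- by move=> t; exact: measurableD.
- exact: index_enum_uniq.
(* Disjointness: [t1] and [t2] list the same values, and off [N] a value determines its index. *)
- move=> t1 t2 _ _ [w [[/leadingP l1 Nw] [/leadingP l2 _]]].
  have [_ _ t1E] := l1 y0 (injN _ Nw); have [_ _ t2E] := l2 y0 (injN _ Nw).
  by apply/ffunP => k; apply: (injN _ Nw); rewrite t1E t2E.
- exact: measurable_funTS.
- by move=> w _; rewrite lee_fin.
apply: eq_bigr => t _.
transitivity (\int[P]_(w in leading B y t `\` N) (h (X (t ord_max) w))%:E)%E.
  apply: eq_integral => w; rewrite inE => -[/leadingP l1 Nw].
  by have [_ _ ->] := l1 y0 (injN _ Nw).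
rewrite -ge0_negligible_integral//; last 2 first.
- apply: measurable_funTS; apply/measurable_EFinP.
  exact: measurableT_comp mh _.
- by move=> w _; rewrite lee_fin.
apply: integral_above => //; last exact: measurable_increasing_part.
by move=> k; rewrite inE negbK codom_f.
Qed.

Lemma spacing_gt0 w : injective (X ^~ w) -> 0 < spacing X r w.
Proof. by move=> injX; rewrite subr_gt0 order_stat_lt. Qed.

(** The probability is the integral of 1 over the event at threshold [y]. It is turned into the
    integral of the tail ratio over the event at threshold 0, which is almost surely no restriction,
    and then pushed forward to the law of [V]. *)
Lemma is_cond_prob_spacing y : DFR F -> 0 <= y ->
  is_cond_prob (P := P) [set w | (y%:E < (spacing X r w)%:E)%E] V
    (fun u => tail_ratio F y (n - r) (\sum_(l < r) tnth u l)).
Proof.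
move=> dfr y0.
have [F0 F1 ndF] := distribution_function_bounds (hF (Ordinal rn)).
have mF : measurable_fun setT F by exact: nondecreasing_measurable.
pose m := (n - r)%N; pose G := tail_ratio F y m.
have m0 : (0 < m)%N by rewrite subn_gt0.
have G0 x : 0 <= G x by exact: tail_ratio_ge0.
have mG : measurable_fun setT G.
  by apply: nondecreasing_measurable => //; exact: tail_ratio_nondecreasing.
have mGsum : measurable_fun setT
    (fun u : r.-tuple R => G (\sum_(l < r) tnth u l)).
  apply: measurableT_comp mG _; apply: measurable_sum => l.
  exact: measurable_tnth.
split=> // [u|B mB]; first by rewrite G0 tail_ratio_le1.
have mV : measurable (V @^-1` B).
  by rewrite -[X in measurable X]setTI; exact: measurable_prefix_vector.
have mD z : measurable [set w | z < spacing X r w].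
  rewrite -[X in measurable X]setTI.
  by apply: (measurable_fun_ltr _ _ measurableT (Y := [set true])).
have mC := measurable_increasing_part mB.
rewrite [X in P (X `&` _)](_ : _ = [set w | y < spacing X r w]); last first.
  by apply/seteqP; split=> w /=; rewrite lte_fin.
transitivity (\int[P]_(w in [set w | (y < spacing X r w)%R] `&` V @^-1` B)
    (cst 1 (order_stat X r' w))%:E)%E.
  rewrite [RHS](eq_integral (cst 1%E))// integral_cst ?mul1e//.
  exact: measurableI.
rewrite (integral_spacing_gt (h := cst 1))//.
(* Exchange threshold [y] with weight 1 for threshold 0 with weight [G], term by term in [t]. *)
transitivity (\int[P]_(w in [set w | (0 < spacing X r w)%R] `&` V @^-1` B)
    (G (order_stat X r' w))%:E)%E.
  rewrite integral_spacing_gt//; apply: eq_bigr => t _.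
  have mpow z : measurable_fun (increasing_part B) (fun u : r.-tuple R =>
      (1 - F (tnth u ord_max + z)) ^+ #|complement t|).
    apply: measurable_funTS; apply: measurable_funX; apply: measurable_funB => //.
    apply: measurableT_comp mF _; apply: measurable_funD => //.
    exact: measurable_tnth.
  have Fpow z x : 0 <= (1 - F (x + z)) ^+ #|complement t|.
    by rewrite exprn_ge0// subr_ge0.
  have mint z (h : R -> R) : measurable_fun setT h ->
      measurable_fun (increasing_part B) (fun u : r.-tuple R =>
      (h (tnth u ord_max) * (1 - F (tnth u ord_max + z)) ^+ #|complement t|)%:E).
    move=> mh; apply/measurable_EFinP; apply: measurable_funM => //.
    by apply: measurable_funTS; apply: measurableT_comp mh _; exact: measurable_tnth.
  (* A repeated index contradicts strict increase, so a non-injective [t] contributes 0 to both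
     sides. For injective [t] the complement has [n - r] elements, the exponent in [G]. *)
  have [injt|ninjt] := pselect (injective t); last first.
    have C0 : distribution P (subvector X t) (increasing_part B) = 0%E.
      rewrite /distribution /pushforward (_ : _ @^-1` _ = set0) ?measure0//.
      apply/seteqP; split=> // w [_ incr]; apply: ninjt => k l tkl.
      apply/val_inj; have [kl|lk|//] := ltngtP k l.
        by have := incr _ _ kl; rewrite !tnth_mktuple tkl ltxx.
      by have := incr _ _ lk; rewrite !tnth_mktuple tkl ltxx.
    by rewrite !null_set_integral//; exact: mint.
  have cardK : #|complement t| = m.
    rewrite (_ : complement t = ~: [set j in codom t])%SET; last first.
      by apply/setP => j; rewrite !inE.
    by rewrite cardsCs finset.setCK cardsE card_codom// !card_ord.
  apply: ge0_ae_eq_integral => //.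
  - exact: mint.
  - exact: mint.
  - by move=> u _; rewrite lee_fin mul1r.
  - by move=> u _; rewrite lee_fin mulr_ge0.
  (* The integrands agree by [tail_ratioE] except where [F] vanishes at the last entry, a null set
     by [cdf_eq0_negligible]. *)
  exists [set u : r.-tuple R | F (tnth u ord_max) == 0]; split.
  - rewrite -[X in measurable X]setTI.
    apply: (measurable_fun_eqr _ _ measurableT (Y := [set true])) => //.
    by apply: measurableT_comp mF _; exact: measurable_tnth.
  - have := cdf_eq0_negligible (X (t ord_max)).
    rewrite (_ : [set w | _] = [set w | F (X (t ord_max) w) == 0]).
      move=> /negligibleP <-; last first.
        rewrite -[X in measurable X]setTI.
        apply: (measurable_fun_eqr _ _ measurableT (Y := [set true])) => //.
        exact: measurableT_comp mF _.
      congr (P _); apply/seteqP; split=> w /=; by rewrite tnth_mktuple.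
    apply/seteqP; split=> w /=; rewrite hF; first by move=> [->].
    by move=> /eqP ->.
  - move=> u /= /not_implyP[_ Gu]; apply/negPn/negP => Fu; apply: Gu.
    by rewrite mul1r addr0 cardK tail_ratioE.
have [N [mN N0 tiesN]] := ties_negligible indX atomless.
transitivity (\int[P]_(w in V @^-1` B) (G (order_stat X r' w))%:E)%E.
  have mGos : measurable_fun setT (fun w => (G (order_stat X r' w))%:E).
    apply/measurable_EFinP; apply: measurableT_comp mG _.
    exact: measurable_order_stat.
  rewrite (ge0_negligible_integral mN)//; last 3 first.
  - exact: measurableI.
  - exact: measurable_funTS.
  - by move=> w _; rewrite lee_fin.
  rewrite [RHS](ge0_negligible_integral mN)//; last 2 first.
  - exact: measurable_funTS.
  - by move=> w _; rewrite lee_fin.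
  congr (integral _ _ _); apply/seteqP; split=> w /=; first by move=> [[]].
  move=> [Bw Nw]; split=> //; split=> //; apply: spacing_gt0.
  by apply: contrapT => /tiesN.
rewrite ge0_integral_pushforward//; last 2 first.
- by apply: measurable_funTS; exact/measurable_EFinP.
- by move=> u _; rewrite lee_fin.
apply: eq_integral => w _ /=; congr (G _)%:E; rewrite -sum_spacing.
by apply: eq_bigr => l _; rewrite tnth_mktuple.
Qed.

End spacings.

(** * Trivial thresholds and the conclusion *)

Lemma is_cond_prob0 (d : measure_display) (T : measurableType d) (R : realType)
    (P : probability T R) d' (U : measurableType d') (V : {RV P >-> U}) :
  is_cond_prob set0 V (fun=> 0).
Proof.
split=> // [u|B mB]; first by rewrite lexx ler01.
by rewrite set0I measure0 integral0.
Qed.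

Lemma is_cond_probT (d : measure_display) (T : measurableType d) (R : realType)
    (P : probability T R) d' (U : measurableType d') (V : {RV P >-> U}) :
  is_cond_prob setT V (fun=> 1).
Proof.
split=> // [u|B mB]; first by rewrite lexx ler01.
by rewrite setTI integral_cst// mul1e.
Qed.

(** This holds at every outcome, ties included, so that for a negative threshold the survival event
    is the whole space. *)
Lemma spacing_ge0 (d : measure_display) (T : measurableType d) (R : realType)
    (P : probability T R) n (X : 'I_n -> {RV P >-> R}) k w :
  (k.+1 < n)%N -> 0 <= spacing X k.+1 w.
Proof.
move=> kn; rewrite subr_ge0.
have size_s : size (sort <=%R [seq X j w | j <- enum 'I_n]) = n.
  by rewrite size_sort size_map size_enum_ord.
apply: (sorted_leq_nth le_trans le_refl) => //; rewrite ?inE ?size_s//.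
- exact: (sort_sorted le_total).
- exact: ltnW.
Qed.

Theorem proposition14 (disp : measure_display) (T : measurableType disp)
    (R : realType) (P : probability T R) (d : nat)
    (X : 'I_d -> {RV P >-> R}) (F f : R -> R) :
  (2 <= d)%N ->
  mutually_independent X ->
  (forall i, has_distribution_function (X i) F) ->
  (forall i, has_density (X i) f) ->
  DFR F ->
  CIS (fun i : 'I_d => spacing X i).
Proof.
move=> _ indX hF hf dfr [[//|r'] rn] _ y.
have [F0 F1 ndF] := distribution_function_bounds (hF (Ordinal rn)).
(* A finite [y >= 0] calls for the tail ratio. For negative [y] and for [-oo] the event is sure, for
   [+oo] it is empty, and constant versions serve. *)
case: y => [y| |].
- have [y0|y0] := leP 0 y.
    exists (fun u => tail_ratio F y (d - r'.+1) (\sum_(l < r'.+1) tnth u l)).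
      apply: is_cond_prob_spacing => // j x.
      exact: atomless_has_density (hf j).
    move=> u v uv; apply: tail_ratio_nondecreasing => //.
    by apply: ler_sum => l _.
  exists (fun=> 1) => //; rewrite (_ : [set w | _] = setT).
    exact: is_cond_probT.
  apply/seteqP; split=> // w _; rewrite /= lte_fin.
  by apply: lt_le_trans y0 _; exact: spacing_ge0.
- exists (fun=> 0) => //; rewrite (_ : [set w | _] = set0).
    exact: is_cond_prob0.
  by apply/seteqP; split=> // w; rewrite /= ltNge leey.
- exists (fun=> 1) => //; rewrite (_ : [set w | _] = setT).
    exact: is_cond_probT.
  by apply/seteqP; split=> // w _; rewrite /= ltNyr.
Qed.
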